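(* Let $X,Y$ be independent, almost surely finite real-valued random variables. (1) Assume $P(X>Y)=0$. If $P(X=Y)=0$, then time and cause are independent for $X,Y$. If $P(X=Y)>0$, then time and cause are independent for $X,Y$ if and only if there is some $c\in\mathbb{R}$ such that $P(X=c)=P(Y\ge c)=1$. (2) Similarly with $X,Y$ interchanged: assume $P(Y>X)=0$. If $P(X=Y)=0$, then time and cause are independent for $X,Y$. If $P(X=Y)>0$, then time and cause are independent for $X,Y$ if and only if there is some $c\in\mathbb{R}$ such that $P(Y=c)=P(X\ge c)=1$.
   Context: A random variable $Z$ is independent of an event $A$ if $P(\{Z\le t\}\cap A)=P(Z\le t)P(A)$ for all $t\in\mathbb{R}$. For random variables $X,Y$, ''time and cause are independent'' means that the random variable $X\wedge Y=\min(X,Y)$ is independent of each of the events $\{X>Y\}$, $\{X<Y\}$ and $\{X=Y\}$. *)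

(* Defs.v *)
From mathcomp Require Import all_boot all_order all_algebra.
From mathcomp Require Import all_classical all_reals all_analysis.
From mathcomp Require Import measurable_realfun.

Set Implicit Arguments.
Unset Strict Implicit.
Unset Printing Implicit Defensive.

Import Order.TTheory GRing.Theory Num.Theory.
Local Open Scope classical_set_scope.
Local Open Scope ereal_scope.

Definition indep_RV {d d1 d2 : measure_display} {T : measurableType d}
    {T1 : measurableType d1} {T2 : measurableType d2} {R : realType}
    (P : probability T R) (X : {RV P >-> T1}) (Y : {RV P >-> T2}) : Prop :=
  forall (A : set T1) (B : set T2), measurable A -> measurable B ->
    P (X @^-1` A `&` Y @^-1` B) = P (X @^-1` A) * P (Y @^-1` B).

(* Random variables that are only almost surely finite take values in \bar R;
   the threshold t nevertheless ranges over the reals. *)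
Definition indep_RV_event {d : measure_display} {T : measurableType d}
    {R : realType} (P : probability T R) (Z : T -> \bar R) (A : set T) : Prop :=
  forall t : R, P ([set w | Z w <= t%:E] `&` A) =
                P [set w | Z w <= t%:E] * P A.

Definition time_cause_indep {d : measure_display} {T : measurableType d}
    {R : realType} (P : probability T R) (X Y : {RV P >-> \bar R}) : Prop :=
  let Z := fun w => Order.min (X w) (Y w) in
  [/\ indep_RV_event P Z [set w | X w > Y w],
      indep_RV_event P Z [set w | X w < Y w]
    & indep_RV_event P Z [set w | X w = Y w]].

(* Main.v *)
(* If X <= Y almost surely and X, Y are independent, then for every t the event
   {X > t, Y <= t} is null, so P(X > t) = 0 or P(Y <= t) = 0.  In the latter
   case {X <= t, X = Y} is null as well, and as min(X, Y) = X almost surely,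
   independence of {X = Y} with P(X = Y) > 0 gives P(X <= t) = 0.  Hence every
   level event {X <= t} is trivial, which makes X almost surely constant. *)
Require Import Defs.
From mathcomp Require Import all_boot all_order all_algebra.
From mathcomp Require Import all_classical all_reals all_analysis.
From mathcomp Require Import measurable_realfun.

Import Order.TTheory GRing.Theory Num.Theory.
Local Open Scope classical_set_scope.
Local Open Scope ereal_scope.

(** Events are tested only at real thresholds, so separating two extended reals needs a real in
    between even when an endpoint is infinite. *)
Lemma ereal_dense (R : realType) (x y : \bar R) :
  x < y -> exists r : R, x < r%:E < y.
Proof.
case: x y => [x| |] [y| |] // xy.
- by exists ((x + y) / 2)%R; rewrite !lte_fin !midf_lt.
- by exists (x + 1)%R; rewrite lte_fin ltrDl ltr01 ltry.
- by exists (y - 1)%R; rewrite lte_fin ltrBlDr ltrDl ltr01 ltNyr.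
- by exists 0%R; rewrite ltNyr ltry.
Qed.

Section null_and_full_events.
Context {d : measure_display} {T : measurableType d} {R : realType}.
Variable P : probability T R.
Implicit Types A B : set T.

Lemma prob_eq0_ae {A} : measurable A ->
  P A = 0 <-> {ae P, forall w, ~ A w}.
Proof.
by move=> mA; rewrite -(negligibleP P mA) -[in X in X <-> _](setCK A).
Qed.

Lemma prob_eq1_ae {A} : measurable A ->
  P A = 1 <-> {ae P, forall w, A w}.
Proof.
move=> mA; have mCA := measurableC mA; split=> [PA1|].
  suff : P (~` A) = 0 by move/(negligibleP P mCA).
  by rewrite probability_setC// PA1 subee.
move=> /(negligibleP P mCA) PCA0.
by rewrite -(setCK A) probability_setC// PCA0 sube0.
Qed.

Lemma prob_setI_trivial A B : measurable A -> measurable B ->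
  P B = 0 \/ P B = 1 -> P (A `&` B) = P A * P B.
Proof.
move=> mA mB [PB|PB]; rewrite PB.
  rewrite mule0; apply: (@subset_measure0 _ _ _ P _ B) => //.
  exact: measurableI.
rewrite mule1 [RHS](measureDI P mA mB).
rewrite [X in _ = X + _](_ : _ = 0) ?add0e//.
have PCB : P (~` B) = 0 by rewrite probability_setC// PB subee.
apply: (@subset_measure0 _ _ _ P _ (~` B)) => //.
- exact: measurableD.
- exact: measurableC.
Qed.

End null_and_full_events.

(** A real [t] strictly between the essential infimum and the essential supremum would refute both
    alternatives at level [t]. Hence the supremum is at most the infimum, and [X] is squeezed almost
    surely between them. *)
Lemma zero_one_levels_cst {d : measure_display} {T : measurableType d}
    {R : realType} {P : probability T R} {X : {RV P >-> \bar R}} :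
  {ae P, forall w, X w \is a fin_num} ->
  (forall t : R, {ae P, forall w, X w <= t%:E} \/
                 {ae P, forall w, t%:E < X w}) ->
  exists c : R, {ae P, forall w, X w = c%:E}.
Proof.
move=> Xfin X01.
(* Positive total mass makes the almost-everywhere filter proper, so that a point can later be
   extracted from an almost sure property. *)
have PT : 0 < P [set: T] by rewrite probability_setT.
have ae_proper := ae_properfilter_algebraOfSetsType PT.
have sup_le_inf : ess_sup_inf.ess_sup P X <= ess_sup_inf.ess_inf P X.
  rewrite leNgt; apply/negP => /ereal_dense[t /andP[inf_t t_sup]].
  have [/ess_sup_inf.ess_supP|tX] := X01 t; first by rewrite leNgt t_sup.
  suff /ess_sup_inf.ess_infP : {ae P, forall w, t%:E <= X w}.
    by rewrite leNgt inf_t.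
  by apply: filterS tX => w /ltW.
have Xcst : {ae P, forall w, X w = ess_sup_inf.ess_sup P X}.
  have := ess_sup_inf.ess_sup_ge P X; have := ess_sup_inf.ess_inf_le P X.
  apply: filterS2 => w infX Xsup; apply/eqP.
  by rewrite eq_le Xsup (le_trans sup_le_inf).
(* The essential supremum lives in [\bar R]; a single point where [X] is finite and equals it shows
   that it is real. *)
have [w [wfin weq]] := filter_ex (filterI Xfin Xcst).
exists (fine (X w)).
by apply: filterS Xcst => v ->; rewrite fineK.
Qed.

Lemma time_cause_indepC {d : measure_display} {T : measurableType d}
    {R : realType} {P : probability T R} {X Y : {RV P >-> \bar R}} :
  time_cause_indep X Y <-> time_cause_indep Y X.
Proof.
suff sym (U V : {RV P >-> \bar R}) :
    time_cause_indep U V -> time_cause_indep V U by split; exact: sym.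
rewrite /time_cause_indep => -[UV VU UeV].
rewrite (_ : (fun w => Order.min (V w) (U w)) =
             (fun w => Order.min (U w) (V w))); last first.
  by apply/funext => w; rewrite minC.
split=> //.
rewrite (_ : [set w | V w = U w] = [set w | U w = V w])//.
by apply/seteqP; split.
Qed.

Lemma indep_RV_sym {d d1 d2 : measure_display} {T : measurableType d}
    {T1 : measurableType d1} {T2 : measurableType d2} {R : realType}
    {P : probability T R} {X : {RV P >-> T1}} {Y : {RV P >-> T2}} :
  indep_RV X Y -> indep_RV Y X.
Proof. by move=> XY A B mA mB; rewrite setIC XY// muleC. Qed.

Section ordered_pair.
Context {d : measure_display} {T : measurableType d} {R : realType}.
Context {P : probability T R} {X Y : {RV P >-> \bar R}}.

Let mX : measurable_fun [set: T] X. Proof. exact: measurable_funPT. Qed.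
Let mY : measurable_fun [set: T] Y. Proof. exact: measurable_funPT. Qed.

Let mgt : measurable [set w | X w > Y w].
Proof. by rewrite -[X in measurable X]setTI; exact: measurable_lte. Qed.
Let mlt : measurable [set w | X w < Y w].
Proof. by rewrite -[X in measurable X]setTI; exact: measurable_lte. Qed.
Let meq : measurable [set w | X w = Y w].
Proof. by rewrite -[X in measurable X]setTI; exact: measurable_eqe. Qed.
Let mmin (t : R) : measurable [set w | Order.min (X w) (Y w) <= t%:E].
Proof.
rewrite -[X in measurable X]setTI; apply: emeasurable_fun_infty_c => //.
exact: measurable_mine.
Qed.

(** Here the causes are trivial: two are null and the third is therefore full. *)
Lemma time_cause_indep_lt :
  P [set w | X w > Y w] = 0 -> P [set w | X w = Y w] = 0 ->
  time_cause_indep X Y.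
Proof.
move=> gt0 eq0; split=> t; apply: prob_setI_trivial => //; [by left| |by left].
right; apply/prob_eq1_ae => //.
move/(prob_eq0_ae P mgt): gt0; move/(prob_eq0_ae P meq): eq0.
by apply: filterS2 => w /= /eqP XneY /negP; rewrite -leNgt lt_neqAle XneY.
Qed.

(** Here it is the time that is trivial: the minimum is almost surely [c], so each of its level
    events has probability 0 or 1, whatever the cause. *)
Lemma time_cause_indep_cst (c : R) :
  P [set w | X w = c%:E] = 1 -> P [set w | Y w >= c%:E] = 1 ->
  time_cause_indep X Y.
Proof.
have mXc : measurable [set w | X w = c%:E].
  by rewrite -[X in measurable X]setTI; exact: measurable_eqe.
have mYc : measurable [set w | Y w >= c%:E].
  by rewrite -[X in measurable X]setTI; exact: emeasurable_fun_c_infty.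
move=> /(prob_eq1_ae P mXc) Xc /(prob_eq1_ae P mYc) Yc.
have minc : {ae P, forall w, Order.min (X w) (Y w) = c%:E}.
  by apply: filterS2 Xc Yc => w /= -> /min_idPl.
suff trivial_levels (t : R) :
    P [set w | Order.min (X w) (Y w) <= t%:E] = 0 \/
    P [set w | Order.min (X w) (Y w) <= t%:E] = 1.
  by split=> t; rewrite setIC muleC; apply: prob_setI_trivial.
have [ct|tc] := leP c%:E t%:E.
  by right; apply/prob_eq1_ae => //; apply: filterS minc => w /= ->.
left; apply/prob_eq0_ae => //; apply: filterS minc => w /= ->.
by apply/negP; rewrite -ltNge.
Qed.

Lemma time_cause_indep_eq_cst :
  {ae P, forall w, X w \is a fin_num} -> indep_RV X Y ->
  P [set w | X w > Y w] = 0 -> P [set w | X w = Y w] > 0 ->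
  time_cause_indep X Y ->
  exists c : R, P [set w | X w = c%:E] = 1 /\ P [set w | Y w >= c%:E] = 1.
Proof.
move=> Xfin XY /(prob_eq0_ae P mgt) XleY eq_gt0 [_ _ indep_eq].
have mXle (t : R) : measurable [set w | X w <= t%:E].
  by rewrite -[X in measurable X]setTI; exact: emeasurable_fun_infty_c.
have mXgt (t : R) : measurable [set w | X w > t%:E].
  by rewrite -[X in measurable X]setTI; exact: emeasurable_fun_o_infty.
have mYle (t : R) : measurable [set w | Y w <= t%:E].
  by rewrite -[X in measurable X]setTI; exact: emeasurable_fun_infty_c.
have X01 (t : R) : {ae P, forall w, X w <= t%:E} \/
                   {ae P, forall w, t%:E < X w}.
  have : P [set w | X w > t%:E] * P [set w | Y w <= t%:E] = 0.
    (* Both events are written as preimages of intervals to bring them into the form that [indep_RV]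
       accepts. *)
    rewrite -preimage_itvoy -preimage_itvNyc -XY; [|exact: emeasurable_itv..].
    rewrite preimage_itvoy preimage_itvNyc; apply/prob_eq0_ae.
      exact: measurableI.
    apply: filterS XleY => w /= + [tX Yt]; apply.
    exact: le_lt_trans Yt tX.
  move/eqP; rewrite mule_eq0 => /orP[] /eqP.
    move/(prob_eq0_ae P (mXgt t)) => Xt; left.
    by apply: filterS Xt => w /negP; rewrite -leNgt.
  move=> /(prob_eq0_ae P (mYle t)) Yt; right.
  have : P [set w | Order.min (X w) (Y w) <= t%:E] *
         P [set w | X w = Y w] = 0.
    rewrite -indep_eq; apply/prob_eq0_ae; first exact: measurableI.
    (* Where [X] and [Y] agree, the minimum is [Y], which almost surely exceeds [t]. *)
    by apply: filterS Yt => w /= Yt [] /[swap] XYw; rewrite XYw minxx.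
  move/eqP; rewrite mule_eq0 (gt_eqF eq_gt0) orbF => /eqP.
  (* Only the inclusion of [X w <= t%:E] in the level event of the minimum is used here. *)
  move=> /(prob_eq0_ae P (mmin t)); apply: filterS => w /= mint.
  by rewrite ltNge; apply/negP => Xt; apply: mint; rewrite ge_min Xt.
have [c Xc] := zero_one_levels_cst Xfin X01.
exists c; split; apply/prob_eq1_ae => //.
- by rewrite -[X in measurable X]setTI; exact: measurable_eqe.
- by rewrite -[X in measurable X]setTI; exact: emeasurable_fun_c_infty.
- by apply: filterS2 XleY Xc => w /= /negP + <-; rewrite -leNgt.
Qed.

End ordered_pair.

Theorem proposition1 (d : measure_display) (T : measurableType d)
    (R : realType) (P : probability T R) (X Y : {RV P >-> \bar R})
    (Xfin : {ae P, forall w, X w \is a fin_num})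
    (Yfin : {ae P, forall w, Y w \is a fin_num})
    (XYindep : indep_RV X Y) :
  (P [set w | X w > Y w] = 0 ->
     (P [set w | X w = Y w] = 0 -> time_cause_indep X Y) /\
     (P [set w | X w = Y w] > 0 ->
        (time_cause_indep X Y <->
         exists c : R, P [set w | X w = c%:E] = 1 /\
                       P [set w | Y w >= c%:E] = 1))) /\
  (P [set w | Y w > X w] = 0 ->
     (P [set w | X w = Y w] = 0 -> time_cause_indep X Y) /\
     (P [set w | X w = Y w] > 0 ->
        (time_cause_indep X Y <->
         exists c : R, P [set w | Y w = c%:E] = 1 /\
                       P [set w | X w >= c%:E] = 1))).
Proof.
have eqC : [set w | X w = Y w] = [set w | Y w = X w].
  by apply/seteqP; split.
split=> le; split.
- exact: time_cause_indep_lt.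
- move=> eq_gt0; split; first exact: time_cause_indep_eq_cst.
  by case=> c []; exact: time_cause_indep_cst.
- by rewrite eqC => eq0; apply/time_cause_indepC; exact: time_cause_indep_lt.
(* All hypotheses are symmetric up to exchanging the variables, so the first case applies to the
   pair [Y], [X]. *)
- rewrite eqC => eq_gt0; rewrite time_cause_indepC; split.
    exact: (time_cause_indep_eq_cst Yfin (indep_RV_sym XYindep)).
  by case=> c []; exact: time_cause_indep_cst.
Qed.
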